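(* Let $\mathcal H$ be a real Hilbert space, let $\Phi:\mathcal H\to\mathbb R$ be a convex differentiable function whose gradient $\nabla\Phi$ is Lipschitz continuous on bounded sets, and suppose $\operatorname{argmin}\Phi\neq\emptyset$. Let $t_0>0$, $\alpha\ge 3$, and let $g:[t_0,+\infty[\to\mathcal H$ satisfy $\int_{t_0}^{+\infty}\tau\|g(\tau)\|\,d\tau<+\infty$. Let $x:[t_0,+\infty[\to\mathcal H$ be any orbit of $$\ddot x(t)+\frac{\alpha}{t}\dot x(t)+\nabla\Phi(x(t))=g(t),$$ and set $x_0=x(t_0)$. Then $$\Phi(x(t))-\min_{\mathcal H}\Phi=\mathcal O\left(\frac1{t^2}\right)\quad (t\to+\infty).$$ Precisely, let $x^*\in\operatorname{argmin}\Phi$ and $$C=\frac{2}{\alpha-1}t_0^2\left(\Phi(x_0)-\inf_{\mathcal H}\Phi\right)+(\alpha-1)\left\|x_0-x^*+\frac{t_0}{\alpha-1}\dot x(t_0)\right\|^2 .$$ Then for all $t\ge t_0$, $$\frac{2}{\alpha-1}t^2\left(\Phi(x(t))-\inf_{\mathcal H}\Phi\right)\le C+2\left(\left(\frac{C}{\alpha-1}\right)^{1/2}+\frac1{\alpha-1}\int_{t_0}^{\infty}\tau\|g(\tau)\|\,d\tau\right)\int_{t_0}^{\infty}\tau\|g(\tau)\|\,d\tau,$$ and moreover $$\sup_{t\ge t_0}\left\|x(t)-x^*+\frac{t}{\alpha-1}\dot x(t)\right\|\le\left(\frac{C}{\alpha-1}\right)^{1/2}+\frac1{\alpha-1}\int_{t_0}^{\infty}\tau\|g(\tau)\|\,d\tau<+\infty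 .$$
   Context: $\|\cdot\|$ is the norm of $\mathcal H$ associated with its scalar product $\langle\cdot,\cdot\rangle$. An orbit (trajectory) is a classical global solution of the differential equation on $[t_0,+\infty[$. *)

(* Defs.v *)
From HB Require Import structures.
From mathcomp Require Import all_boot all_order all_algebra.
From mathcomp Require Import all_classical all_reals all_analysis.

Set Implicit Arguments.
Unset Strict Implicit.
Unset Printing Implicit Defensive.

Import Order.TTheory GRing.Theory Num.Theory.
Import numFieldNormedType.Exports.

Local Open Scope classical_set_scope.
Local Open Scope ring_scope.

(* Canonical filter structure (as the library has for [nbhs x]), needed to use
   the Landau notation [=O_] at infinity. *)
Canonical pinfty_nbhs_filter_on (R : numFieldType) :=
  FilterType (pinfty_nbhs R) _.

Definition argmin (R : realType) (T : Type) (f : T -> R) : set T :=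
  [set u | forall v, f u <= f v].

(* The gradient of [f] at [u] is the Riesz representative of the Frechet
   differential; its existence for every [u] is the differentiability of [f]. *)
Definition is_gradient (R : realType) (H : completeNormedModType R)
    (dot : {dot H for idfun}) (f : H -> R) (grad_f : H -> H) : Prop :=
  forall u, is_diff u (f : H -> R^o) (dot (grad_f u)).

(* [f' t] is the derivative of [f] relative to [D] at every [t] in [D]: the
   increments [s - t] are restricted to [s] in [D], so that for [D = `[t0, +oo[]
   it is the two-sided derivative for [t > t0], the right derivative at [t0],
   and values of [f] outside [D] are irrelevant. *)
Definition is_derivative_on (R : realType) (V : normedModType R)
    (D : set R) (f f' : R -> V) : Prop :=
  forall t, D t ->
    (s - t)^-1 *: (f s - f t) @[s --> within D t^'] --> f' t.

(* Functions on [t0, +oo[ are represented by functions on R that are only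
   constrained there.  [v] is the velocity of the trajectory [x]. *)
Definition is_orbit (R : realType) (H : completeNormedModType R)
    (grad_Phi : H -> H) (t0 alpha : R) (g : R -> H) (x v : R -> H) : Prop :=
  is_derivative_on `[t0, +oo[ x v /\
  exists a : R -> H,
    is_derivative_on `[t0, +oo[ v a /\
    forall t, t0 <= t -> a t + (alpha / t) *: v t + grad_Phi (x t) = g t.

(* Main.v *)
Require Import Defs.
From HB Require Import structures.
From mathcomp Require Import all_boot all_order all_algebra.
From mathcomp Require Import all_classical all_reals all_analysis.
From mathcomp Require Import measurable_realfun ring lra.

(* With w(t) = x(t) - xs + t/(alpha-1) x'(t) and
     E(t) = 2/(alpha-1) t^2 (Phi(x(t)) - min Phi) + (alpha-1) |w(t)|^2,
   the equation and the convexity inequality give E' <= 2 t |w| |g|.  Since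
   sqrt(alpha-1) |w| <= sqrt E, this reads (sqrt E)' <= t |g| / sqrt(alpha-1),
   so that sqrt(E(t)) <= sqrt C + I / sqrt(alpha-1), and both bounds follow by
   squaring, resp. by dividing by sqrt(alpha-1).

   The forcing term g is not assumed continuous, so E' exists everywhere but
   need not be integrable, and the fundamental theorem of calculus is not
   available to integrate the differential inequality.  Instead, a function
   whose derivative is everywhere at most an integrable h >= 0 is compared to
   a nondecreasing function U whose slopes exceed h and whose total increment is
   at most the integral of h plus e (a Vitali-Caratheodory argument). *)

Import Order.TTheory GRing.Theory Num.Theory.
Import numFieldNormedType.Exports.

Local Open Scope classical_set_scope.
Local Open Scope ring_scope.

Set Implicit Arguments.
Unset Strict Implicit.
Unset Printing Implicit Defensive.

(** * Increments of functions whose derivative has an integrable bound *)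

(** The supremum [m] of the points [t] with [F a <= F t] is itself such a point, by local comparison
    with points of the set close to [m]; if [m < b], the same comparison yields a larger one. *)
Lemma locally_nondecreasing_le (R : realType) (F : R -> R) (a b : R) :
  a <= b ->
  (forall t, a <= t <= b -> exists2 d : R, 0 < d &
     forall s, a <= s <= b -> `|s - t| < d ->
       (t <= s -> F t <= F s) /\ (s <= t -> F s <= F t)) ->
  F a <= F b.
Proof.
move=> ab locF.
pose S := [set t | a <= t <= b /\ F a <= F t].
have Sa : S a by split; rewrite ?lexx.
have supS : has_sup S.
  by split; [exists a | exists b => t [/andP[_ tb] _]].
set m := sup S.
have am : a <= m by exact: sup_upper_bound.
have mb : m <= b by apply: ge_sup; [exists a | move=> t [/andP[_ tb] _]].
have mab : a <= m <= b by rewrite am mb.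
have [d d0 locm] := locF m mab.
have Fm : F a <= F m.
  have [s [sab Fs] ms] := sup_adherent d0 supS.
  have sm : s <= m by apply: sup_upper_bound.
  apply: (le_trans Fs); apply: (locm s sab _).2 => //.
  by rewrite distrC ger0_norm ?subr_ge0// ltrBlDl -ltrBlDr.
have [->//|mnb] := eqVneq b m.
have mltb : m < b by rewrite lt_neqAle mb eq_sym mnb.
pose s := Num.min b (m + d / 2).
have ms : m < s by rewrite lt_min mltb/= ltrDl divr_gt0.
have sab : a <= s <= b by rewrite (le_trans am (ltW ms)) ge_min lexx.
have sd : `|s - m| < d.
  rewrite ger0_norm ?subr_ge0 ?(ltW ms)// ltrBlDl.
  by rewrite (@le_lt_trans _ _ (m + d / 2))// ?ge_min ?lexx ?orbT//; lra.
have Ss : S s by split=> //; rewrite (le_trans Fm)// (locm s sab sd).1// ltW.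
by have := sup_upper_bound supS Ss; rewrite leNgt ms.
Qed.

Local Notation mu := (@lebesgue_measure _).

(* U(t) = \sum_k c_k mu(V_k `&` [a, t]), where V_k is open, contains the level
   set A_k of h between c_k - dl and c_k, and has almost the same measure. *)
Lemma integrable_majorant (R : realType) (h : R -> R) (a b e : R) :
  a <= b -> 0 < e -> (forall t, a <= t <= b -> 0 <= h t) ->
  (@lebesgue_measure R).-integrable `[a, b] (EFin \o h) ->
  exists U : R -> R,
    U b - U a <= \int[@lebesgue_measure R]_(t in `[a, b]) h t + e /\
    forall t, a <= t <= b -> exists2 K, h t < K & exists2 d : R, 0 < d &
      forall s s', a <= s -> s <= s' -> s' <= b ->
        `|s - t| < d -> `|s' - t| < d -> K * (s' - s) <= U s' - U s.
Proof.
move=> ab e0 h0 ih.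
have muS (X Y : set R) : measurable X -> measurable Y -> X `<=` Y ->
    (mu X <= mu Y)%E.
  by move=> mX mY XY; rewrite le_measure ?inE; [|exact: mX|exact: mY|].
pose D : set R := `[a, b]%classic.
have mD : measurable D by exact: measurable_itv.
have muD : (mu D = (b - a)%:E)%E.
  rewrite /D lebesgue_measure_itv/= lte_fin.
  by case: ltP => // ba; rewrite (@le_anti _ _ a b) ?ab// subrr.
(* [dl] is the height of a level: rounding [h] up to the top of its level costs at most
   [dl * (b - a) <= e / 2] in the integral. The [+ 1] keeps the denominator positive when
   [a = b]. *)
pose dl : R := e / 2 / (b - a + 1).
have ba0 : 0 <= b - a by rewrite subr_ge0.
have dl0 : 0 < dl by rewrite !divr_gt0// ltr_wpDl.
have dlba : dl * (b - a) <= e / 2.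
  rewrite /dl mulrAC ler_pdivrMr ?ltr_wpDl//.
  by apply: ler_wpM2l; rewrite ?divr_ge0 ?(ltW e0)// lerDl.
pose c k : R := k.+1%:R * dl.
have c0 k : 0 < c k by rewrite mulr_gt0.
pose A k := D `&` h @^-1` `[k%:R * dl, c k[.
have mh : measurable_fun D h.
  by apply/measurable_EFinP; exact: measurable_int ih.
have mA k : measurable (A k) by apply: mh => //; exact: measurable_itv.
(* The level is recovered from [h t], so the [A k] are pairwise disjoint. *)
have Atrunc k t : A k t -> Num.trunc (h t / dl) = k.
  move=> [_] /=; rewrite in_itv/= => /andP[k1 k2].
  by apply: truncn_def; rewrite ler_pdivlMr// ltr_pdivrMr// k1.
have muAfin k : (mu (A k) < +oo)%E.
  rewrite (@le_lt_trans _ _ (mu D)) ?muD ?ltry// -muD muS//.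
  by move=> t [].
(* The other half of [e] pays for the open sets: an excess measure below [ee k / c k] with weight
   [c k] costs at most [ee k], and the [ee k] sum to [e / 2]. *)
pose ee k : R := e / 2 / (2 ^ k.+1)%:R.
have ee0 k : 0 < ee k by rewrite !divr_gt0// ltr0n expn_gt0.
have eck k : 0 < ee k / c k by rewrite divr_gt0.
have /choice[V HV] : forall k, exists V : set R, [/\ open V, A k `<=` V &
    (mu (V `\` A k) < (ee k / c k)%:E)%E].
  by move=> k; exact: (lebesgue_regularity_outer (mA k) (muAfin k) (eck k)).
have mV k : measurable (V k) by apply: open_measurable; case: (HV k).
pose W (s : R) : \bar R :=
  (\sum_(0 <= k <oo) ((c k)%:E * mu (V k `&` `[a, s])))%E.
have mVI k s : measurable (V k `&` `[a, s]).
  by apply: measurableI => //; exact: measurable_itv.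
have term0 k s : (0 <= (c k)%:E * mu (V k `&` `[a, s]))%E.
  by rewrite mule_ge0 ?measure_ge0// lee_fin ltW.
have W0 s : (0 <= W s)%E by apply: nneseries_ge0.
have muVI k : (mu (V k `&` D) <= mu (A k) + (ee k / c k)%:E)%E.
  have [oO AO lO] := HV k.
  apply: (@le_trans _ _ (mu (A k `|` (V k `\` A k)))).
    apply: muS; [exact: mVI | by apply: measurableU => //; exact: measurableD |].
    by move=> s [Os Ds]; have [As|nAs] := pselect (A k s); [left|right].
  apply: (le_trans (measureU2 mu (mA k) (measurableD (mV k) (mA k)))).
  by rewrite leeD2l// ltW.
(* Each open set is first replaced by its level, at total cost [e / 2]; the weighted measures of the
   levels are then compared with the integral of [h + dl], which is at least [c k] on [A k]. *)
have Wb : (W b <= (\int[mu]_(t in D) h t + e)%:E)%E.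
  apply: (@le_trans _ _
    (\sum_(0 <= k <oo) ((c k)%:E * mu (A k) + (ee k)%:E))%E).
    apply: lee_nneseries => // k _.
    have -> : (ee k)%:E = ((c k)%:E * (ee k / c k)%:E)%E.
      by rewrite -EFinM mulrC divfK// gt_eqF.
    by rewrite -muleDr// ?lee_wpmul2l// ?lee_fin ?ltW// ge0_adde_def ?inE// lee_fin ltW.
  apply: (@le_trans _ _ (\sum_(0 <= k <oo) ((c k)%:E * mu (A k)) + (e / 2)%:E)%E).
    apply: epsilon_trick; last by rewrite divr_ge0// ltW.
    by move=> k; rewrite mule_ge0 ?measure_ge0// lee_fin ltW.
  pose h' t : \bar R := ((h t)%:E + dl%:E)%E.
  have mh' : measurable_fun D h'.
    by apply: emeasurable_funD => //; exact/measurable_EFinP.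
  have h'0 t : D t -> (0 <= h' t)%E.
    rewrite /D/= in_itv/= => /h0 ht.
    by rewrite adde_ge0// lee_fin// ltW.
  have AD k : A k `<=` D by exact: subIsetl.
  have S1 : (\sum_(0 <= k <oo) ((c k)%:E * mu (A k))
      <= \sum_(0 <= k <oo) \int[mu]_(t in A k) h' t)%E.
    apply: lee_nneseries => k _.
      by rewrite mule_ge0 ?measure_ge0// lee_fin ltW.
    rewrite -integral_cst; last exact: mA.
    apply: ge0_le_integral; first exact: mA.
    - by move=> t _; rewrite lee_fin ltW.
    - exact: measurable_cst.
    - exact: (measurable_funS mD (AD k) mh').
    move=> t [_] /=; rewrite in_itv/= => /andP[kh _].
    by rewrite /h' -EFinD lee_fin /c -natr1 mulrDl mul1r lerD2r.
  have S2 : (\sum_(0 <= k <oo) \int[mu]_(t in A k) h' t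
      <= \int[mu]_(t in D) h' t)%E.
    have UAD : \bigcup_k A k `<=` D by move=> t [k _ /AD].
    have mUA : measurable (\bigcup_k A k) by exact: bigcup_measurable.
    rewrite -ge0_integral_bigcup.
    - exact: (ge0_subset_integral mu mUA mD mh' h'0 UAD).
    - exact: mA.
    - exact: (measurable_funS mD UAD mh').
    - by move=> t /UAD; exact: h'0.
    - apply/trivIsetP => i j _ _ ij; apply/seteqP; split=> // t [/Atrunc ti /Atrunc tj].
      by rewrite -ti -tj eqxx in ij.
  have S3 : (\int[mu]_(t in D) h' t = (\int[mu]_(t in D) h t + dl * (b - a))%:E)%E.
    rewrite /h' ge0_integralD.
    - have := integral_cst mu mD dl%:E.
      rewrite /cst => ->; rewrite [X in (_ * X)%E]muD /Rintegral [RHS]EFinD fineK ?EFinM//.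
      exact: integrable_fin_num.
    - exact: mD.
    - by move=> t; rewrite /D/= in_itv/= => /h0; rewrite lee_fin.
    - exact/measurable_EFinP.
    - by move=> t _; rewrite lee_fin ltW.
    - exact: measurable_cst.
  rewrite (le_trans (leeD2r _ (le_trans S1 S2)))// S3 -EFinD lee_fin.
  by lra.
have Wle s s' : s <= s' -> (W s <= W s')%E.
  move=> ss'; apply: lee_nneseries => // k _.
  apply: lee_wpmul2l; first by rewrite lee_fin ltW.
  apply: muS; [exact: mVI|exact: mVI|].
  by apply: setIS => r /=; rewrite !in_itv/= => /andP[-> /le_trans]; exact.
have Wfin s : s <= b -> W s \is a fin_num.
  move=> sb; rewrite ge0_fin_numE// (le_lt_trans (Wle _ _ sb))//.
  by rewrite (le_lt_trans Wb)// ltry.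
exists (fine \o W); split=> /=.
  have : fine (W b) <= \int[mu]_(t in D) h t + e.
    by rewrite -lee_fin fineK// Wfin.
  by apply: le_trans; rewrite gerBl fine_ge0.
move=> t tab; pose k := Num.trunc (h t / dl).
have Akt : A k t.
  split; first by rewrite /D/= in_itv.
  rewrite /= in_itv/= /c -ler_pdivlMr// -ltr_pdivrMr//.
  by apply: truncn_itv; rewrite divr_ge0 ?h0// ltW.
(* The top [c k] of the half-open level of [t] is strictly above [h t]. *)
exists (c k); first by case: Akt => _ /=; rewrite in_itv/= => /andP[].
have [oO AO _] := HV k.
have /nbhs_ballP[d /= d0 dO] : nbhs t (V k) by apply: open_nbhs_nbhs; split=> //; exact: AO.
exists d => // s s' as_ ss' s'b sd s'd.
have sub : `]s, s'] `<=` V k.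
  move=> r /=; rewrite in_itv/= => /andP[sr rs']; apply: dO.
  rewrite /ball/=; move: sd s'd; rewrite !ltr_distlC => /andP[s1 s2] /andP[s3 s4].
  by apply/andP; split; lra.
(* The term of index [k] is isolated: as []s, s']] lies in [V k], it grows by exactly
   [c k * (s' - s)], while the other terms do not decrease. *)
have key : (W s + (c k * (s' - s))%:E <= W s')%E.
  rewrite /W (@nneseriesD1 _ _ k)// [leRHS](@nneseriesD1 _ _ k)//.
  rewrite addeAC leeD//; last first.
    apply: lee_nneseries => // i _.
    apply: lee_wpmul2l; first by rewrite lee_fin ltW.
    apply: muS; [exact: mVI|exact: mVI|].
    by apply: setIS => r /=; rewrite !in_itv/= => /andP[-> /le_trans]; exact.
  have -> : V k `&` `[a, s'] = (V k `&` `[a, s]) `|` `]s, s']%classic.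
    apply/seteqP; split=> r.
      move=> [Or] /=; rewrite !in_itv/= => /andP[ar rs'].
      by have [rs|rs] := leP r s; [left; rewrite ar | right].
    move=> [[Or]|] /=; rewrite in_itv/= => /andP[r1 r2].
      by split=> //=; rewrite ?in_itv/= r1 (le_trans r2).
    split; first by apply: sub; rewrite /= in_itv/= r1.
    by rewrite /= ?in_itv/= r2 (le_trans as_ (ltW r1)).
  have disj : (V k `&` `[a, s]) `&` `]s, s'] = set0.
    apply/seteqP; split=> // r [[_]] /=; rewrite !in_itv/= => /andP[_ rs] /andP[].
    by rewrite ltNge rs.
  rewrite (measureU mu (mVI k s) (measurable_itv `]s, s']) disj).
  rewrite ge0_muleDr// leeD2l// EFinM; apply: lee_wpmul2l; first by rewrite lee_fin ltW.
  have mus : (mu `]s, s'] = (s' - s)%:E)%E.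
    rewrite lebesgue_measure_itv/= lte_fin.
    by case: ltP => // s's; rewrite (@le_anti _ _ s s') ?ss'// subrr.
  by have := lexx (s' - s)%:E; rewrite -{2}mus.
rewrite lerBrDl -lee_fin EFinD !fineK ?Wfin//.
exact: le_trans ss' s'b.
Qed.

(** With [U] the majorant for [h] and [e], [U - f] is locally nondecreasing: near [t] the slopes of
    [U] are at least some [K > h t >= f' t], and the difference quotients of [f] stay below [K]. *)
Lemma Rintegral_ge_increment (R : realType) (f f' h : R -> R) (a b : R) :
  a <= b ->
  (forall t, a <= t <= b -> is_derive t 1 f (f' t)) ->
  (forall t, a <= t <= b -> f' t <= h t) ->
  (forall t, a <= t <= b -> 0 <= h t) ->
  (@lebesgue_measure R).-integrable `[a, b] (EFin \o h) ->
  f b - f a <= \int[@lebesgue_measure R]_(t in `[a, b]) h t.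
Proof.
move=> ab df f'h h0 ih; apply/ler_addgt0Pr => e e0.
have [U [Uab locU]] := integrable_majorant ab e0 h0 ih.
suff : U a - f a <= U b - f b by move=> Uf; apply: le_trans Uab; lra.
apply: (@locally_nondecreasing_le _ (fun t => U t - f t)) => // t tab.
have [K hK [d d0 Ud]] := locU t tab.
have /cvgr_lt/(_ K (le_lt_trans (f'h t tab) hK)) :
    r^-1 *: (f (r *: 1 + t) - f t) @[r --> 0^'] --> f' t.
  by have [dft <-] := df t tab; exact: dft.
move=> /nbhs_ballP[d' /= d'0 fd'].
have quot s : `|s - t| < d' -> s != t -> (s - t)^-1 * (f s - f t) < K.
  move=> std' st; have bst : ball (0 : R) d' (s - t) by rewrite -ball_normE/= sub0r normrN.
  have := fd' (s - t) bst.
  by rewrite /= subr_eq0 st scaler1 subrK; apply.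
have [ta tb] := andP tab.
exists (Num.min d d'); first by rewrite lt_min d0 d'0.
move=> s /andP[sa sb]; rewrite lt_min => /andP[sd sd'].
have tt : `|t - t| < d by rewrite subrr normr0.
split=> [|]; rewrite le_eqVlt => /predU1P[->//|st].
- have := Ud t s ta (ltW st) sb tt sd.
  have := quot s sd'; rewrite gt_eqF// => /(_ isT).
  by rewrite mulrC ltr_pdivrMr ?subr_gt0//; lra.
- have := Ud s t sa (ltW st) tb sd tt.
  have := quot s sd'; rewrite lt_eqF// => /(_ isT).
  by rewrite mulrC ltr_ndivrMr ?subr_lt0//; lra.
Qed.

(** * Derivatives of vector-valued curves *)

(* Affine extension below [t0] turns the one-sided derivative at [t0] into a
   two-sided one. *)
Lemma is_derive_extension (R : realType) (V : normedModType R)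
    (f f' : R -> V) (t0 : R) : is_derivative_on `[t0, +oo[ f f' ->
  forall t, t0 <= t -> is_derive t 1
    (fun s => if t0 <= s then f s else f t0 + (s - t0) *: f' t0) (f' t).
Proof.
move=> df t t0t; set F := fun s => _.
suff cvF : r^-1 *: (F (r *: 1 + t) - F t) @[r --> 0^'] --> f' t.
  by apply: DeriveDef; [apply: cvgP cvF|apply: cvg_lim cvF].
apply/cvgrPdist_lt => e e0.
have Dt : `[t0, +oo[%classic t by rewrite /= in_itv/= t0t.
have /cvgrPdist_lt/(_ e e0) := df t Dt.
move=> /nbhs_ballP[d /= d0 fd].
(* For [t > t0] this radius avoids the affine branch; at [t = t0] the difference quotient of that
   branch equals [f' t0]. *)
pose d1 := if t0 == t then d else Num.min d (t - t0).
have d10 : 0 < d1.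
  by rewrite /d1; case: eqVneq => // t0t'; rewrite lt_min d0 subr_gt0 lt_neqAle t0t' t0t.
have d1d : d1 <= d by rewrite /d1; case: eqVneq => // _; rewrite ge_min lexx.
have Ft : F t = f t by rewrite /F t0t.
apply/nbhs_ballP; exists d1 => //= r.
rewrite -ball_normE/= sub0r normrN scaler1 => rd1 r0.
rewrite Ft /F; case: ifPn => [t0r|rt0].
  have bt : ball t d (r + t).
    by rewrite -ball_normE/= opprD addrCA subrr addr0 normrN (lt_le_trans rd1).
  have := fd _ bt; rewrite /= addrK; apply; first by rewrite -subr_eq0 addrK.
  by rewrite in_itv/= t0r.
rewrite -ltNge in rt0; move: rd1; rewrite /d1; case: eqVneq => [<-|t0t']; last first.
  by rewrite lt_min => /andP[_]; rewrite ltr_norml => /andP[]; lra.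
by move=> _; rewrite addrK addrAC subrr add0r scalerA mulVf// scale1r subrr normr0.
Qed.

Lemma is_derive_cvgE (R : realType) (V : normedModType R) (f : R -> V) (t : R) (l : V) :
  is_derive t 1 f l <-> r^-1 *: (f (r + t) - f t) @[r --> 0^'] --> l.
Proof.
have -> : (fun r : R => r^-1 *: (f (r + t) - f t)) =
    (fun r : R => r^-1 *: ((f \o shift t) (r *: (1 : R)) - f t)).
  by apply/funext => r /=; rewrite scaler1.
split=> [[df <-] //|cvf].
by apply: DeriveDef; [apply: cvgP cvf|apply: cvg_lim cvf].
Qed.

Lemma is_derive_cvg_shift (R : realType) (V : normedModType R) (f : R -> V)
  (t : R) (l : V) : is_derive t 1 f l -> f (r + t) @[r --> 0^'] --> f t.
Proof.
move=> [df _]; apply/continuous_withinNshiftx.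
by apply: differentiable_continuous; exact/derivable1_diffP.
Qed.

Lemma is_derive_scalefun (R : realType) (V : normedModType R) (k : R -> R)
    (f : R -> V) (t k' : R) (f' : V) :
  is_derive t 1 k k' -> is_derive t 1 f f' ->
  is_derive t 1 (fun s => k s *: f s) (k' *: f t + k t *: f').
Proof.
move=> dk df; apply/is_derive_cvgE.
have -> : (fun r : R => r^-1 *: (k (r + t) *: f (r + t) - k t *: f t)) =
    (fun r => (r^-1 *: (k (r + t) - k t)) *: f (r + t) +
              k t *: (r^-1 *: (f (r + t) - f t))).
  apply/funext => r; rewrite (_ : r^-1 *: (k _ - k t) = r^-1 * (k (r + t) - k t))//.
  rewrite -scalerA (scalerA (k t)) (mulrC (k t)).
  rewrite -scalerA -scalerDr; congr (_ *: _).
  by rewrite scalerBl scalerBr addrA subrK.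
apply: cvgD; last by apply: cvgZr; exact/is_derive_cvgE.
by apply: cvgZ; [exact/is_derive_cvgE|exact: is_derive_cvg_shift df].
Qed.

(** * Scalar product and norm *)

Lemma dotC (R : realType) (H : normedModType R)
    (dot : {dot H for idfun}) (u v : H) : dot u v = dot v u.
Proof. by rewrite hermC/= expr0 mul1r. Qed.

Lemma sqr_normD (R : realType) (H : normedModType R)
    (dot : {dot H for idfun}) (dot_norm : forall u : H, dot u u = `|u| ^+ 2)
    (u v : H) :
  `|u + v| ^+ 2 = `|u| ^+ 2 + 2 * dot u v + `|v| ^+ 2.
Proof. by rewrite -!dot_norm linearDl/= !linearDr/= (dotC dot v u); ring. Qed.

(** Cauchy-Schwarz, read off the squared triangle inequality. *)
Lemma dot_le_norm (R : realType) (H : normedModType R)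
    (dot : {dot H for idfun}) (dot_norm : forall u : H, dot u u = `|u| ^+ 2)
    (u v : H) :
  dot u v <= `|u| * `|v|.
Proof.
have : `|u + v| ^+ 2 <= (`|u| + `|v|) ^+ 2 by rewrite ler_pXn2r ?nnegrE ?ler_normD ?addr_ge0.
by rewrite (sqr_normD dot_norm); nra.
Qed.

(** Polarization reduces joint continuity of [dot] to continuity of the norm. *)
Lemma cvg_dot (R : realType) (H : normedModType R)
    (dot : {dot H for idfun}) (dot_norm : forall u : H, dot u u = `|u| ^+ 2)
    (T : Type) (F : set_system T) (f g : T -> H) (u v : H) :
  Filter F -> f x @[x --> F] --> u -> g x @[x --> F] --> v ->
  dot (f x) (g x) @[x --> F] --> dot u v.
Proof.
move=> FF fu gv.
have polar (w z : H) : dot w z = (`|w + z| ^+ 2 - `|w| ^+ 2 - `|z| ^+ 2) / 2.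
  by rewrite (sqr_normD dot_norm); field.
under eq_fun do rewrite polar.
rewrite polar; apply: cvgMl.
by apply: cvgB; [apply: cvgB|]; rewrite !expr2; apply: cvgM;
  apply: cvg_norm => //; exact: cvgD.
Qed.

(** Since [|p|^2 - |q|^2 = dot (p + q) (p - q)], the difference quotient is a scalar product of two
    convergent factors. *)
Lemma is_derive_sqr_norm (R : realType) (H : normedModType R)
    (dot : {dot H for idfun}) (dot_norm : forall u : H, dot u u = `|u| ^+ 2)
    (f : R -> H) (t : R) (f' : H) :
  is_derive t 1 f f' ->
  is_derive t 1 (fun s => `|f s| ^+ 2 : R) (2 * dot (f t) f').
Proof.
move=> df; apply/is_derive_cvgE.
have -> : (fun r : R => r^-1 *: (`|f (r + t)| ^+ 2 - `|f t| ^+ 2)) =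
    (fun r => dot (f (r + t) + f t) (r^-1 *: (f (r + t) - f t))).
  apply/funext => r; rewrite linearZr_LR/=; congr (_ *: _).
  by rewrite linearDl/= !linearBr/= !dot_norm (dotC dot (f t) (f (r + t))); ring.
have -> : 2 * dot (f t) f' = dot (f t + f t) f' by rewrite [in RHS]linearDl/=; ring.
apply: (cvg_dot dot_norm); last exact/is_derive_cvgE.
by apply: cvgD; [exact: is_derive_cvg_shift df|exact: cvg_cst].
Qed.

(** * Convexity and the energy inequality *)

(** If the derivative at [u] along [w - u] exceeded [f w - f u], so would the difference quotient
    for small [r > 0], which convexity on the segment forbids as soon as [r <= 1]. *)
Lemma convex_gradient_le (R : realType) (H : completeNormedModType R)
    (dot : {dot H for idfun}) (f : H -> R) (grad_f : H -> H) :
  convex_function setT (f : H -> R^o) -> is_gradient dot f grad_f ->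
  forall u w, f u + dot (grad_f u) (w - u) <= f w.
Proof.
move=> cf gf u w; rewrite -lerBrDl leNgt; apply/negP => lt_dot.
have := gf u => -[dfu dfE].
have : r^-1 *: (f (r *: (w - u) + u) - f u) @[r --> 0^'] --> dot (grad_f u) (w - u).
  have -> : dot (grad_f u) (w - u) = 'D_(w - u) (f : H -> R^o) u.
    by rewrite deriveE// dfE.
  exact: (@diff_derivable _ _ _ (f : H -> R^o) u (w - u) dfu).
move=> /cvgr_gt/(_ _ lt_dot)/nbhs_ballP[d /= d0 fd].
pose r := Num.min 1 (d / 2).
have r0 : 0 < r by rewrite lt_min ltr01 divr_gt0.
have r1 : r <= 1 by rewrite ge_min lexx.
have rd : r < d by rewrite gt_min; apply/orP; right; lra.
have br : ball (0 : R) d r by rewrite -ball_normE/= sub0r normrN gtr0_norm.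
have := fd r br; rewrite /= gt_eqF// => /(_ isT); apply/negP; rewrite -leNgt.
rewrite (_ : r^-1 *: _ = r^-1 * (f (r *: (w - u) + u) - f u))// mulrC ler_pdivrMr//.
have := cf (Itv01 (ltW r0) r1) w u; rewrite !inE => /(_ I I).
rewrite convRE [X in f X <= _](_ : _ = r *: (w - u) + u); last first.
  by rewrite /conv/= /unstable.onem scalerBl scale1r scalerBr addrA addrAC.
by rewrite /= /unstable.onem; lra.
Qed.

(** The weight [s / (alpha - 1)] in [w] makes the velocity drop out of [w']. In [E'] the products of
    gradient and velocity then cancel, convexity makes the remaining gradient terms nonpositive, and
    Cauchy-Schwarz bounds the contribution of [g]. *)
Lemma energy_derive_le (R : realType) (H : completeNormedModType R)
    (dot : {dot H for idfun}) (Phi : H -> R) (grad_Phi : H -> H)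
    (alpha t : R) (x v : R -> H) (a g xs : H) :
  (forall u, dot u u = `|u| ^+ 2) ->
  convex_function setT (Phi : H -> R^o) -> is_gradient dot Phi grad_Phi ->
  argmin Phi xs -> 3 <= alpha -> 0 < t ->
  is_derive t 1 x (v t) -> is_derive t 1 v a ->
  a + (alpha / t) *: v t + grad_Phi (x t) = g ->
  let w s := x s - xs + (s / (alpha - 1)) *: v s in
  exists2 E' : R,
    is_derive t 1 (fun s => 2 / (alpha - 1) * s ^+ 2 * (Phi (x s) - Phi xs)
                            + (alpha - 1) * `|w s| ^+ 2) E' &
    E' <= 2 * t * (`|w t| * `|g|).
Proof.
move=> dot_norm cPhi gPhi minxs al3 t0 dx dv eqn w.
have al1 : alpha - 1 != 0 by rewrite gt_eqF//; lra.
set gr := grad_Phi (x t).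
have dPhi : is_derive t 1 (fun s => Phi (x s)) (dot gr (v t)).
  have [dfx dfE] : is_diff t ((Phi : H -> R^o) \o x) (dot gr \o ( *:%R ^~ (v t))).
    apply: is_diff_comp; last exact: gPhi.
    have [dxt <-] := dx; split; first exact/derivable1_diffP.
    by rewrite deriv1E// derive1E.
  apply: DeriveDef; first exact/derivable1_diffP.
  by rewrite deriveE// dfE/= scale1r.
have dw : is_derive t 1 w ((t / (alpha - 1)) *: (g - gr)).
  have dk : is_derive t 1 (fun s : R => s / (alpha - 1)) (alpha - 1)^-1.
    have -> : (fun s : R => s / (alpha - 1)) = (alpha - 1)^-1 \*: (id : R -> R).
      by apply/funext => s /=; rewrite mulrC.
    by apply: is_derive_eq; rewrite scaler1.
  have dkv := is_derive_scalefun dk dv.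
  have dxx : is_derive t 1 (fun s => x s - xs) (v t - 0) by exact: is_deriveB.
  apply: (is_derive_eq (is_deriveD dxx dkv)).
  rewrite -eqn -/gr subr0 addrK scalerDr scalerA.
  (* The weighted friction term thus cancels [x'] together with the velocity term produced by
     differentiating the weight. *)
  have -> : t / (alpha - 1) * (alpha / t) = 1 + (alpha - 1)^-1.
    by field; rewrite al1 gt_eqF.
  by rewrite scalerDl scale1r addrA addrC.
have dsq : is_derive t 1 (fun s : R => 2 / (alpha - 1) * s ^+ 2) (4 / (alpha - 1) * t).
  have dX : is_derive t 1 ((2 / (alpha - 1)) \*: ((id : R -> R) ^+ 2))
      ((2 / (alpha - 1)) *: ((2%:R * t ^+ 1) *: (1 : R))).
    by apply: is_deriveZ; exact: is_deriveX.
  apply: (is_derive_eq dX); rewrite scaler1 expr1 /GRing.scale/=; ring.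
have dgap : is_derive t 1 (fun s => Phi (x s) - Phi xs) (dot gr (v t) - 0).
  exact: is_deriveB.
have dE := is_deriveD (is_deriveM dsq dgap)
  (is_deriveZ (alpha - 1) (is_derive_sqr_norm dot_norm dw)).
exists (2 / (alpha - 1) * t ^+ 2 * dot gr (v t) +
    (Phi (x t) - Phi xs) * (4 / (alpha - 1) * t) +
    (alpha - 1) * (2 * dot (w t) ((t / (alpha - 1)) *: (g - gr)))).
  by apply: (is_derive_eq dE); rewrite subr0.
have convex_le : Phi (x t) - Phi xs <= dot gr (x t - xs).
  have := convex_gradient_le cPhi gPhi (x t) xs.
  by rewrite -/gr -opprB linearNr/=; lra.
have gap0 : 0 <= Phi (x t) - Phi xs by rewrite subr_ge0.
have cs := dot_le_norm dot_norm (w t) g.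
have dotwgr : dot (w t) gr = dot gr (x t - xs) + t / (alpha - 1) * dot gr (v t).
  by rewrite (dotC dot (w t)) /w linearDr/= linearZr_LR.
have -> : dot (w t) ((t / (alpha - 1)) *: (g - gr)) =
    t / (alpha - 1) * (dot (w t) g - dot (w t) gr) by rewrite linearZr_LR/= linearBr.
rewrite dotwgr.
set p := dot gr (v t); set q := dot gr _ in convex_le *.
have -> : 2 / (alpha - 1) * t ^+ 2 * p + (Phi (x t) - Phi xs) * (4 / (alpha - 1) * t)
   + (alpha - 1) * (2 * (t / (alpha - 1) * (dot (w t) g - (q + t / (alpha - 1) * p))))
   = 2 * t * dot (w t) g - 2 * t * (q - 2 / (alpha - 1) * (Phi (x t) - Phi xs)).
  by field.
(* The threshold [alpha >= 3] enters here: the term from differentiating [t ^+ 2] must be absorbed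
   by the convexity inequality. *)
have coef : 2 / (alpha - 1) <= 1 by rewrite ler_pdivrMr; lra.
have : 2 / (alpha - 1) * (Phi (x t) - Phi xs) <= q.
  by apply: le_trans convex_le; rewrite ler_piMl.
move=> hq; rewrite lerBlDr; apply: ler_wpDr.
  by rewrite mulr_ge0 ?mulr_ge0 ?subr_ge0// ltW.
by rewrite ler_wpM2l// mulr_ge0// ltW.
Qed.

(** A nonlinear Gronwall inequality: dividing by [2 sqrt E] turns the bound on [E'] into
    [(sqrt E)' <= h]. *)
Lemma sqrt_increment_le (R : realType) (E E' h : R -> R) (a b : R) :
  a <= b ->
  (forall t, a <= t <= b -> is_derive t 1 E (E' t)) ->
  (forall t, a <= t <= b -> 0 <= E t) ->
  (forall t, a <= t <= b -> 0 <= h t) ->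
  (forall t, a <= t <= b -> E' t <= 2 * Num.sqrt (E t) * h t) ->
  (@lebesgue_measure R).-integrable `[a, b] (EFin \o h) ->
  Num.sqrt (E b) <= Num.sqrt (E a) + \int[@lebesgue_measure R]_(t in `[a, b]) h t.
Proof.
(* [E] may vanish, where [Num.sqrt] is not differentiable: shift it by e^2. *)
move=> ab dE E0 h0 E'h ih; apply/ler_addgt0Pr => e e0.
have e20 : 0 < e ^+ 2 by rewrite exprn_gt0.
have Ee t : a <= t <= b -> 0 < E t + e ^+ 2 by move=> /E0 Et; rewrite ltr_wpDl.
have dsqrt t : a <= t <= b ->
    is_derive t 1 (fun s => Num.sqrt (E s + e ^+ 2))
      ((2 * Num.sqrt (E t + e ^+ 2))^-1 * (E' t + 0)).
  move=> tab; apply: (@is_derive1_comp _ Num.sqrt (fun s => E s + e ^+ 2)).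
    exact/is_derive1_sqrt/Ee.
  by apply: is_deriveD; exact: dE.
have sqrt_le t : a <= t <= b ->
    (2 * Num.sqrt (E t + e ^+ 2))^-1 * (E' t + 0) <= h t.
  move=> tab; rewrite addr0 mulrC ler_pdivrMr ?mulr_gt0 ?sqrtr_gt0 ?Ee//.
  apply: (le_trans (E'h t tab)); rewrite mulrC ler_wpM2l ?h0// ler_wpM2l//.
  by apply: ler_wsqrtr; rewrite lerDl ltW.
have := Rintegral_ge_increment ab dsqrt sqrt_le h0 ih.
have [aab bab] : a <= a <= b /\ a <= b <= b by rewrite !lexx ab.
have : Num.sqrt (E b) <= Num.sqrt (E b + e ^+ 2).
  by apply: ler_wsqrtr; rewrite lerDl ltW.
(* The shift costs at most [e], which is the slack available. *)
have : Num.sqrt (E a + e ^+ 2) <= Num.sqrt (E a) + e.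
  rewrite -[leRHS]ger0_norm ?addr_ge0 ?sqrtr_ge0 ?(ltW e0)// -sqrtr_sqr.
  apply: ler_wsqrtr.
  rewrite sqrrD sqr_sqrtr ?E0// lerD2r lerDl mulrn_wge0// mulr_ge0 ?sqrtr_ge0//.
  exact: ltW.
lra.
Qed.

(** * Bounds along an orbit *)

Theorem theorem2p1 (R : realType)
  (H : completeNormedModType R) (dot : {dot H for idfun})
  (dot_norm : forall u : H, dot u u = `|u| ^+ 2)
  (Phi : H -> R) (grad_Phi : H -> H)
  (Phi_convex : convex_function setT (Phi : H -> R^o))
  (Phi_grad : is_gradient dot Phi grad_Phi)
  (grad_lip : forall B : set H, bounded_set B ->
     [lipschitz grad_Phi u | u in B])
  (argmin_neq0 : argmin Phi !=set0)
  (t0 alpha : R) (t0_gt0 : 0 < t0) (alpha_ge3 : 3 <= alpha)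
  (g : R -> H)
  (g_int : (@lebesgue_measure R).-integrable `[t0, +oo[
     (fun tau : R => (tau * `|g tau|)%:E))
  (x v : R -> H) (x_orbit : is_orbit grad_Phi t0 alpha g x v) :
  let infPhi := inf (range Phi) in
  let I := \int[@lebesgue_measure R]_(tau in `[t0, +oo[) (tau * `|g tau|) in
  ((fun t => Phi (x t) - infPhi) : R -> R^o) =O_+oo
    (fun t => 1 / t ^+ 2 : R^o)
  /\
  forall xs : H, argmin Phi xs ->
    let C := 2 / (alpha - 1) * t0 ^+ 2 * (Phi (x t0) - infPhi)
             + (alpha - 1) * `|x t0 - xs + (t0 / (alpha - 1)) *: v t0| ^+ 2 in
    (forall t, t0 <= t ->
       2 / (alpha - 1) * t ^+ 2 * (Phi (x t) - infPhi)
       <= C + 2 * (Num.sqrt (C / (alpha - 1)) + 1 / (alpha - 1) * I) * I)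
    /\
    (ereal_sup [set (`|x t - xs + (t / (alpha - 1)) *: v t|)%:E
                  | t in `[t0, +oo[]
       <= (Num.sqrt (C / (alpha - 1)) + 1 / (alpha - 1) * I)%:E < +oo)%E.
Proof.
move=> infPhi I.
have al1 : 0 < alpha - 1 by lra.
have infE xs : argmin Phi xs -> infPhi = Phi xs.
  move=> minxs; apply/eqP; rewrite eq_le; apply/andP; split.
    by apply: ge_inf; [exists (Phi xs) => y [u _ <-]; exact: minxs|exists xs].
  by apply: lb_le_inf; [exists (Phi xs), xs|move=> y [u _ <-]; exact: minxs].
have I0 : 0 <= I.
  apply: Rintegral_ge0 => t /=; rewrite in_itv/= andbT => t0t.
  by rewrite mulr_ge0// (le_trans (ltW t0_gt0)).
pose B C := C + 2 * (Num.sqrt (C / (alpha - 1)) + 1 / (alpha - 1) * I) * I.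
pose W C := Num.sqrt (C / (alpha - 1)) + 1 / (alpha - 1) * I.
(* Both bounds are reduced to pointwise ones with [Phi xs] for the infimum; the Landau estimate
   follows from the first, applied to any one minimizer. *)
suff bounds xs : argmin Phi xs ->
    let C := 2 / (alpha - 1) * t0 ^+ 2 * (Phi (x t0) - Phi xs)
             + (alpha - 1) * `|x t0 - xs + (t0 / (alpha - 1)) *: v t0| ^+ 2 in
    forall t, t0 <= t ->
      2 / (alpha - 1) * t ^+ 2 * (Phi (x t) - Phi xs) <= B C /\
      `|x t - xs + (t / (alpha - 1)) *: v t| <= W C.
  split; last first.
    move=> xs minxs; rewrite (infE xs minxs) => C.
    split; first by move=> t /(bounds xs minxs)[].
    rewrite ltry andbT; apply: ge_ereal_sup => y [t /=].
    by rewrite in_itv/= andbT => /(bounds xs minxs)[_ Wt] <-; rewrite lee_fin.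
  have [xs minxs] := argmin_neq0.
  rewrite (infE xs minxs); set C := (2 / (alpha - 1) * t0 ^+ 2 * (Phi (x t0) - Phi xs)
             + (alpha - 1) * `|x t0 - xs + (t0 / (alpha - 1)) *: v t0| ^+ 2).
  (* [(alpha - 1) / 2] inverts the factor in the first bound; the absolute value and the [+ 1] make
     the constant positive. *)
  pose M := `|(alpha - 1) / 2 * B C| + 1.
  apply/eqO_exP; exists M; first by rewrite /M ltr_wpDl.
  near=> t.
  have t0t : t0 <= t by near: t; apply: nbhs_pinfty_ge; exact: num_real.
  have tgt0 : 0 < t by exact: lt_le_trans t0t.
  rewrite ger0_norm ?subr_ge0; last exact: minxs.
  rewrite ger0_norm; last by rewrite divr_ge0// sqr_ge0.
  rewrite mulrA mulr1 ler_pdivlMr ?exprn_gt0//.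
  have [Bt _] := bounds xs minxs t t0t.
  have : (Phi (x t) - Phi xs) * t ^+ 2 <= (alpha - 1) / 2 * B C.
    rewrite -(ler_pM2l (_ : 0 < 2 / (alpha - 1)))//; last by rewrite divr_gt0.
    rewrite [leRHS](_ : _ = B C); last by field; rewrite gt_eqF.
    by apply: le_trans Bt; rewrite mulrA -mulrA (mulrC _ (t ^+ 2)) mulrA.
  by have := ler_norm ((alpha - 1) / 2 * B C); rewrite /M; lra.
move=> minxs C T t0T.
have [dx [a [dv eqn]]] := x_orbit.
(* The affine prolongation below [t0] gives [E] a two-sided derivative at [t0] as well. *)
set x' := fun s => if t0 <= s then x s else x t0 + (s - t0) *: v t0.
set v' := fun s => if t0 <= s then v s else v t0 + (s - t0) *: a t0.
have x'E s : t0 <= s -> x' s = x s by rewrite /x' => ->.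
have v'E s : t0 <= s -> v' s = v s by rewrite /v' => ->.
pose w s := x' s - xs + (s / (alpha - 1)) *: v' s.
pose E s := 2 / (alpha - 1) * s ^+ 2 * (Phi (x' s) - Phi xs) + (alpha - 1) * `|w s| ^+ 2.
have gap0 s : 0 <= Phi (x' s) - Phi xs by rewrite subr_ge0; exact: minxs.
have pot0 s : 0 <= 2 / (alpha - 1) * s ^+ 2 * (Phi (x' s) - Phi xs).
  by rewrite mulr_ge0 ?gap0// mulr_ge0 ?sqr_ge0// divr_ge0// ltW.
have wE s : (alpha - 1) * `|w s| ^+ 2 <= E s by rewrite lerDr.
have E0 s : 0 <= E s by apply: le_trans (wE s); rewrite mulr_ge0 ?sqr_ge0// ltW.
set k := Num.sqrt (alpha - 1).
have k0 : 0 < k by rewrite sqrtr_gt0.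
have kk : k ^+ 2 = alpha - 1 by rewrite sqr_sqrtr// ltW.
have kwE s : k * `|w s| <= Num.sqrt (E s).
  rewrite -[leLHS]ger0_norm ?mulr_ge0 ?(ltW k0)// -sqrtr_sqr.
  by apply: ler_wsqrtr; rewrite exprMn kk.
have dE t : t0 <= t -> is_derive t 1 E ('D_1 E t) /\
    'D_1 E t <= 2 * Num.sqrt (E t) * (k^-1 * (t * `|g t|)).
  move=> t0t; have tgt0 : 0 < t by exact: lt_le_trans t0t.
  have dx' : is_derive t 1 x' (v' t) by rewrite v'E//; exact: is_derive_extension.
  have dv' : is_derive t 1 v' (a t) by exact: is_derive_extension.
  have eqn' : a t + (alpha / t) *: v' t + grad_Phi (x' t) = g t.
    by rewrite x'E// v'E//; exact: eqn.
  have [E' dE E'le] := energy_derive_le dot_norm Phi_convex Phi_grad minxs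
    alpha_ge3 tgt0 dx' dv' eqn'.
  have [eE vE] := dE; rewrite vE; split=> //; apply: (le_trans E'le).
  (* By [kwE], [|w t|] is at most [sqrt (E t) / k]. *)
  rewrite -/(w t) [leRHS](_ : _ = 2 * t * ((k^-1 * Num.sqrt (E t)) * `|g t|)); last by ring.
  apply: ler_wpM2l; first by rewrite mulr_ge0// ltW.
  by apply: ler_wpM2r => //; rewrite mulrC ler_pdivlMr// mulrC.
have sub : `[t0, T] `<=` `[t0, +oo[.
  by move=> s /=; rewrite !in_itv/= andbT => /andP[].
have iT : (@lebesgue_measure R).-integrable `[t0, T]
    (EFin \o (fun t => t * `|g t|)).
  by apply: (integrableS _ _ _ g_int); [exact: measurable_itv|exact: measurable_itv|].
have sqrtE : Num.sqrt (E T) <= Num.sqrt (E t0) + k^-1 * I.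
  (* The inequality is integrated over [[t0, T]]; the domain is then enlarged to the half-line, the
     integrand being nonnegative there. *)
  apply: (@le_trans _ _ (Num.sqrt (E t0) +
     \int[@lebesgue_measure R]_(t in `[t0, T]) (k^-1 * (t * `|g t|)))).
    apply: (@sqrt_increment_le _ E ('D_1 E)) => //.
    - by move=> t /andP[/dE[]].
    - move=> t /andP[t0t _]; rewrite !mulr_ge0 ?invr_ge0 ?(ltW k0)//.
      exact: le_trans (ltW t0_gt0) t0t.
    - by move=> t /andP[/dE[]].
    - have mT : measurable (`[t0, T]%classic : set (measurableTypeR R)).
        exact: measurable_itv.
      exact: (integrableZl mT k^-1 iT).
  rewrite lerD2l RintegralZl; [|exact: measurable_itv|exact: iT].
  rewrite ler_wpM2l ?invr_ge0 ?(ltW k0)//.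
  apply: fine_le.
  - by apply: integrable_fin_num iT; exact: measurable_itv.
  - by apply: integrable_fin_num g_int; exact: measurable_itv.
  apply: ge0_subset_integral; [exact: measurable_itv|exact: measurable_itv| | |exact: sub].
    exact: measurable_int g_int.
  move=> t /=; rewrite in_itv/= andbT => t0t.
  by rewrite lee_fin mulr_ge0// (le_trans (ltW t0_gt0)).
have EC : E t0 = C by rewrite /E /w x'E ?v'E.
rewrite EC in sqrtE.
have C0 : 0 <= C by rewrite -EC.
set S := Num.sqrt C in sqrtE.
have S0 : 0 <= S by exact: sqrtr_ge0.
have SC : S ^+ 2 = C by rewrite sqr_sqrtr.
(* As [k ^+ 2 = alpha - 1], the second bound is the bound on [sqrt (E T)] divided by [k]. *)
have WE : W C = k^-1 * (S + k^-1 * I).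
  rewrite /W sqrtrM// sqrtrV ?(ltW al1)// -/k -/S -kk; field.
  by rewrite gt_eqF.
split; last first.
  rewrite WE -(x'E T)// -(v'E T)// -/(w T) mulrC ler_pdivlMr// mulrC.
  exact: le_trans (kwE T) sqrtE.
have ET : E T <= (S + k^-1 * I) ^+ 2.
  rewrite -[leLHS]sqr_sqrtr// ler_pXn2r// ?nnegrE ?sqrtr_ge0//.
  exact: le_trans (sqrtr_ge0 _) sqrtE.
apply: (@le_trans _ _ (E T)).
  by rewrite -(x'E T)// lerDl mulr_ge0 ?sqr_ge0// ltW.
apply: (le_trans ET); rewrite /B -/(W C) WE -SC.
(* Here [B C] is [S^2 + 2 S I / k + 2 (I / k)^2], which exceeds [(S + I / k)^2] by [(I / k)^2]. *)
rewrite -subr_ge0 (_ : _ - _ = (k^-1 * I) ^+ 2) ?sqr_ge0//; ring.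
Unshelve. all: by end_near. Qed.
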